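(* There is a natural adjunction $\operatorname{Rep}^{+}\dashv\operatorname{Rec}^{+}$ between the functors $\operatorname{Rep}^{+}\colon\mathcal X^{+}\to\operatorname{Lip}^{+}_1(\mathbb R)\circ\mathcal D$ and $\operatorname{Rec}^{+}\colon\operatorname{Lip}^{+}_1(\mathbb R)\circ\mathcal D\to\mathcal X^{+}$. More precisely, for $Y\in\mathcal X^{+}$ and $Y'\in\operatorname{Lip}^{+}_1(\mathbb R)\circ\mathcal D$ there is a natural bijection that leaves the underlying maps unchanged, $$\operatorname{Hom}_{\operatorname{Lip}^{+}_1(\mathbb R)\circ\mathcal D}(\operatorname{Rep}^{+}(Y),Y')\simeq\operatorname{Hom}_{\mathcal X^{+}}(Y,\operatorname{Rec}^{+}(Y')).$$ The unit of this adjunction is an isomorphism, and $\operatorname{Rep}^{+}$ is fully faithful.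
   Context: A qm-space is a triple $(X,d_X,\mu_X)$ such that: $d_X\colon X\times X\to[0,+\infty)$ satisfies $d_X(x,x)=0$ and the triangle inequality; $d_X^{\mathrm s}(x,y)=\max\{d_X(x,y),d_X(y,x)\}$ is a complete separable metric on $X$; and $\mu_X$ is a Borel probability measure on $(X,d_X^{\mathrm s})$ with full support. $\mathcal X^{+}$ is the category of qm-spaces whose morphisms $X\to Y$ are maps $u$ with $u_*\mu_X=\mu_Y$ and $d_Y(u(x),u(x'))\leq d_X(x,x')$ for all $x,x'$. For a qm-space $X$, $\operatorname{Lip}^{+}_1(X)=\{f\colon X\to\mathbb R\mid f(y)-f(x)\leq d_X(x,y)\ \text{for all }x,y\in X\}$. A gd-set is a triple $(X,F_X,\mu_X)$ where $F_X$ is a nonempty family of real functions on $X$, $d_{F_X}(x,x')=\sup_{f\in F_X}|f(x)-f(x')|$ is a complete separable metric on $X$, and $\mu_X$ is a Borel probability measure on $(X,d_{F_X})$ with full support. $\overline{F_X}$ is the closure of $F_X$ for pointwise convergence. A domination from a gd-set $X$ to a gd-set $Y$ is a Borel measurable map $u\colon X\to Y$ with $u_*\mu_X=\mu_Y$ and $F_Y\circ u=\{f\circ u\mid f\in F_Y\}\subset\overline{F_X}$. $\operatorname{Lip}^{+}_1(\mathbb R)$ is the set of nondecreasing $1$-Lipschitz functions $p\colon\mathbb R\to\mathbb R$. $\operatorname{Lip}^{+}_1(\mathbb R)\circ\mathcal D$ is the category of gd-sets $X$ such that $p\circ f\in\overline{F_X}$ for all $p\in\operatorname{Lip}^{+}_1(\mathbb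 R)$ and $f\in\overline{F_X}$, with dominations as morphisms. $\operatorname{Rep}^{+}(Y)=(Y,\operatorname{Lip}^{+}_1(Y),\mu_Y)$ and $\operatorname{Rec}^{+}(X)=(X,d_X^{+},\mu_X)$ with $d_X^{+}(x,x')=\sup_{f\in\overline{F_X}}\{f(x')-f(x)\}$; both leave underlying maps of morphisms unchanged. *)

(* Defs.v *)
From HB Require Import structures.
From mathcomp Require Import all_boot all_order all_algebra.
From mathcomp Require Import mathcomp_extra boolp classical_sets functions.
From mathcomp Require Import cardinality reals ereal topology measure.
From mathcomp Require Import random_variable lra.

Set Implicit Arguments.
Unset Strict Implicit.
Unset Printing Implicit Defensive.

Import Order.TTheory GRing.Theory Num.Theory.
Import numFieldTopology.Exports.

Local Open Scope classical_set_scope.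
Local Open Scope ring_scope.

Record category := Category {
  obj :> Type ;
  mor : obj -> obj -> Type ;
  idm : forall a, mor a a ;
  compm : forall a b c, mor b c -> mor a b -> mor a c ;
  compm1 : forall a b (f : mor a b), compm f (idm a) = f ;
  comp1m : forall a b (f : mor a b), compm (idm b) f = f ;
  compmA : forall a b c d (h : mor c d) (g : mor b c) (f : mor a b),
    compm h (compm g f) = compm (compm h g) f }.

Arguments mor {_} _ _.
Arguments idm {_} a.
Arguments compm {_ a b c} _ _.

Definition isomorphism (C : category) (a b : C) (f : mor a b) : Prop :=
  exists g : mor b a, compm g f = idm a /\ compm f g = idm b.

Section full_subcategory.
Variables (C : category) (P : C -> Prop).

Definition full_subcategory : category :=
  @Category {a : C | P a} (fun a b => mor (sval a) (sval b))
    (fun a => idm (sval a)) (fun _ _ _ g f => compm g f)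
    (fun _ _ f => compm1 f) (fun _ _ f => comp1m f)
    (fun _ _ _ _ h g f => compmA h g f).

End full_subcategory.

Record functor (C D : category) := Functor {
  fobj :> C -> D ;
  fmap : forall a b : C, mor a b -> mor (fobj a) (fobj b) ;
  fmap_id : forall a, fmap (idm a) = idm (fobj a) ;
  fmap_comp : forall a b c (g : mor b c) (f : mor a b),
    fmap (compm g f) = compm (fmap g) (fmap f) }.

Arguments fmap {C D} F {a b} _ : rename.

Definition functor_id (C : category) : functor C C :=
  @Functor C C id (fun _ _ f => f) (fun _ => erefl) (fun _ _ _ _ _ => erefl).

Section functor_comp.
Variables (C D E : category) (G : functor D E) (F : functor C D).

Definition fmap_comp_fun a b (f : mor a b) := fmap G (fmap F f).

Lemma functor_comp_idm a : fmap_comp_fun (idm a) = idm (G (F a)).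
Proof. by rewrite /fmap_comp_fun !fmap_id. Qed.

Lemma functor_comp_compm a b c (g : mor b c) (f : mor a b) :
  fmap_comp_fun (compm g f) = compm (fmap_comp_fun g) (fmap_comp_fun f).
Proof. by rewrite /fmap_comp_fun !fmap_comp. Qed.

Definition functor_comp : functor C E :=
  Functor functor_comp_idm functor_comp_compm.

End functor_comp.

Definition full (C D : category) (F : functor C D) : Prop :=
  forall (a b : C) (g : mor (F a) (F b)), exists f : mor a b, fmap F f = g.

Definition faithful (C D : category) (F : functor C D) : Prop :=
  forall a b : C, injective (@fmap C D F a b).

Definition fully_faithful (C D : category) (F : functor C D) : Prop :=
  full F /\ faithful F.

Record nat_trans (C D : category) (F G : functor C D) := NatTrans {
  nat_map :> forall a : C, mor (F a) (G a) ;
  nat_mapE : forall (a b : C) (f : mor a b),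
    compm (nat_map b) (fmap F f) = compm (fmap G f) (nat_map a) }.

Definition nat_isomorphism (C D : category) (F G : functor C D)
    (t : nat_trans F G) : Prop :=
  forall a : C, isomorphism (t a).

(** [F] is left adjoint to [G]: hom-set bijections natural in both arguments. *)
Record adjunction (C D : category) (F : functor C D) (G : functor D C) :=
  Adjunction {
  adj_map :> forall (c : C) (d : D), mor (F c) d -> mor c (G d) ;
  adj_bij : forall c d, bijective (@adj_map c d) ;
  adj_natl : forall (c c' : C) (d : D) (f : mor c' c) (g : mor (F c) d),
    adj_map (compm g (fmap F f)) = compm (adj_map g) f ;
  adj_natr : forall (c : C) (d d' : D) (h : mor d d') (g : mor (F c) d),
    adj_map (compm h g) = compm (fmap G h) (adj_map g) }.

Section adj_unit.
Variables (C D : category) (F : functor C D) (G : functor D C).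
Variable phi : adjunction F G.

Definition unit_map (c : C) : mor c (G (F c)) := phi c (F c) (idm (F c)).

Lemma unit_mapE (a b : C) (f : mor a b) :
  compm (unit_map b) f = compm (fmap G (fmap F f)) (unit_map a).
Proof. by rewrite /unit_map -adj_natl -adj_natr comp1m compm1. Qed.

Definition adj_unit : nat_trans (functor_id C) (functor_comp G F) :=
  @NatTrans C C (functor_id C) (functor_comp G F) unit_map unit_mapE.

End adj_unit.

Record is_metric (R : realType) (T : Type) (d : T -> T -> R) : Prop :=
  IsMetric {
  dist_xx : forall x, d x x = 0 ;
  dist_eq : forall x y, d x y = 0 -> x = y ;
  dist_sym : forall x y, d x y = d y x ;
  dist_tri : forall y x z, d x z <= d x y + d y z }.

Definition mspace (R : realType) (T : pointedType) (d : T -> T -> R)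
  (dm : is_metric d) : Type := T.

Section mspace_metric.
Variables (R : realType) (T : pointedType) (d : T -> T -> R).
Variable dm : is_metric d.

HB.instance Definition _ := Pointed.on (mspace dm).
HB.instance Definition _ := isMetric.Build R (mspace dm)
  (dist_xx dm) (dist_eq dm) (dist_sym dm) (dist_tri dm).

End mspace_metric.

(** A [Prop]-valued counterpart of the library's [completeType]. *)
Definition complete (M : puniformType) : Prop :=
  forall F : set_system M, ProperFilter F -> cauchy F -> cvg F.

Definition separable (M : topologicalType) : Prop :=
  exists2 D : set M, countable D & dense D.

Definition borel (M : ptopologicalType) := g_sigma_algebraType (@open M).

Definition full_support (R : realType) (M : ptopologicalType)
    (P : probability (borel M) R) : Prop :=
  forall U : set M, open U -> U !=set0 -> (0 < P U)%E.

Section same_dist.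
Variables (R : realType) (T : pointedType) (d d' : T -> T -> R).
Variables (dm : is_metric d) (dm' : is_metric d').
Hypothesis dd' : forall x y, d x y = d' x y.

Lemma same_dist_eq : d = d'.
Proof. by apply/funext => x; apply/funext => y. Qed.

Lemma complete_same_dist : complete (mspace dm) -> complete (mspace dm').
Proof.
by move: dm dm'; rewrite same_dist_eq => p q; rewrite (Prop_irrelevance p q).
Qed.

Lemma separable_same_dist : separable (mspace dm) -> separable (mspace dm').
Proof.
by move: dm dm'; rewrite same_dist_eq => p q; rewrite (Prop_irrelevance p q).
Qed.

Lemma open_same_dist (U : set T) :
  @open (mspace dm') U -> @open (mspace dm) U.
Proof.
by move: dm dm'; rewrite same_dist_eq => p q; rewrite (Prop_irrelevance p q).
Qed.

Lemma measurable_same_dist (A : set T) :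
  @measurable _ (borel (mspace dm')) A -> @measurable _ (borel (mspace dm)) A.
Proof.
by move: dm dm'; rewrite same_dist_eq => p q; rewrite (Prop_irrelevance p q).
Qed.

Definition same_dist_id (x : borel (mspace dm)) : borel (mspace dm') := x.

Lemma same_dist_id_measurable :
  measurable_fun [set: borel (mspace dm)] same_dist_id.
Proof. by move=> _ A mA; rewrite setTI; exact: measurable_same_dist. Qed.

Definition same_dist_mfun : {mfun borel (mspace dm) >-> borel (mspace dm')} :=
  HB.pack same_dist_id
    (isMeasurableFun.Build _ _ _ _ same_dist_id same_dist_id_measurable).

(** The image of [P] under the identity of [T]: the same values, regarded as a
    measure on the Borel sets of the pointwise equal distance [d']. *)
Definition same_dist_probability (P : probability (borel (mspace dm)) R) :
  probability (borel (mspace dm')) R := distribution P same_dist_mfun.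

Lemma same_dist_probabilityE (P : probability (borel (mspace dm)) R) A :
  same_dist_probability P A = P A.
Proof. by []. Qed.

Lemma full_support_same_dist (P : probability (borel (mspace dm)) R) :
  full_support P -> full_support (same_dist_probability P).
Proof.
move=> fP U oU U0; rewrite same_dist_probabilityE.
by apply: fP => //; exact: open_same_dist.
Qed.

End same_dist.

Arguments complete_same_dist {R T d d' dm} dm' dd' _.
Arguments separable_same_dist {R T d d' dm} dm' dd' _.
Arguments measurable_same_dist {R T d d'} dm {dm'} dd' [A] _.
Arguments same_dist_probability {R T d d' dm} dm' dd' P.
Arguments full_support_same_dist {R T d d' dm} dm' dd' [P] _.

Definition dist_symmetrization (R : realType) (T : Type) (d : T -> T -> R)
  (x y : T) : R := Num.max (d x y) (d y x).

(** The base point of the carrier, required by the library's measurable types,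
    plays no role: morphisms ignore it. *)
Record qmspace (R : realType) := QMSpace {
  qm_carrier :> pointedType ;
  qm_dist : qm_carrier -> qm_carrier -> R ;
  qm_dist_ge0 : forall x y, 0 <= qm_dist x y ;
  qm_dist_xx : forall x, qm_dist x x = 0 ;
  qm_dist_tri : forall y x z, qm_dist x z <= qm_dist x y + qm_dist y z ;
  qm_metric : is_metric (dist_symmetrization qm_dist) ;
  qm_complete : complete (mspace qm_metric) ;
  qm_separable : separable (mspace qm_metric) ;
  qm_mu : probability (borel (mspace qm_metric)) R ;
  qm_full_support : full_support qm_mu }.

Arguments qm_dist {R} X x y : rename.
Arguments qm_metric {R} X : rename.
Arguments qm_mu {R} X : rename.

Definition qm_borel (R : realType) (X : qmspace R) :=
  borel (mspace (qm_metric X)).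

(** Measurability needs no field: it follows from [qm_fun_dist]. *)
Record qm_hom (R : realType) (X Y : qmspace R) := QMHom {
  qm_fun :> X -> Y ;
  qm_fun_mu : forall A, measurable A ->
    pushforward (qm_mu X) (qm_fun : qm_borel X -> qm_borel Y) A = qm_mu Y A ;
  qm_fun_dist : forall x x',
    qm_dist Y (qm_fun x) (qm_fun x') <= qm_dist X x x' }.

Section qm_category.
Variable R : realType.
Implicit Types X Y Z : qmspace R.

Lemma qm_hom_eq X Y (u v : qm_hom X Y) : qm_fun u = qm_fun v -> u = v.
Proof.
case: u v => [u um ud] [v vm vd] /= uv; subst v.
by rewrite (Prop_irrelevance um vm) (Prop_irrelevance ud vd).
Qed.

Definition Lip1_plus X : set (X -> R) :=
  [set f | forall x y, f y - f x <= qm_dist X x y].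

Arguments Lip1_plus X _ : clear implicits.

Lemma Lip1_plus_dist X (z : X) : Lip1_plus X (qm_dist X z).
Proof. by move=> x y; rewrite lerBlDl; exact: qm_dist_tri. Qed.

Definition qm_id X : qm_hom X X :=
  @QMHom R X X id (fun _ _ => erefl) (fun _ _ => lexx _).

Lemma qm_fun_measurable X Y (u : qm_hom X Y) :
  measurable_fun [set: qm_borel X] (u : qm_borel X -> qm_borel Y).
Proof.
apply: (@measurability _ _ (qm_borel X) (qm_borel Y) setT u
  (@open (mspace (qm_metric Y)))) => //.
move=> _ [U oU <-]; rewrite setTI; apply: sub_sigma_algebra.
rewrite openE => x /=; rewrite openE in oU; move/oU.
rewrite /interior -!nbhs_ballE => -[e /= e0 eU]; exists e => //= y.
rewrite ballEmdist/= => xy; apply: eU; rewrite ballEmdist/=.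
by apply: le_lt_trans xy; rewrite ge_max !le_max !qm_fun_dist orbT.
Qed.

Lemma qm_comp_mu X Y Z (v : qm_hom Y Z) (u : qm_hom X Y) A : measurable A ->
  pushforward (qm_mu X) (v \o u : qm_borel X -> qm_borel Z) A = qm_mu Z A.
Proof.
move=> mA; rewrite -(qm_fun_mu v mA) /pushforward -(qm_fun_mu u) //.
by rewrite -[X in measurable X]setTI; exact: (qm_fun_measurable v).
Qed.

Lemma qm_comp_dist X Y Z (v : qm_hom Y Z) (u : qm_hom X Y) x x' :
  qm_dist Z ((v \o u) x) ((v \o u) x') <= qm_dist X x x'.
Proof. exact: le_trans (qm_fun_dist v _ _) (qm_fun_dist u _ _). Qed.

Definition qm_comp X Y Z (v : qm_hom Y Z) (u : qm_hom X Y) : qm_hom X Z :=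
  QMHom (qm_comp_mu v u) (qm_comp_dist v u).

Lemma qm_comp1 X Y (u : qm_hom X Y) : qm_comp u (qm_id X) = u.
Proof. exact: qm_hom_eq. Qed.

Lemma qm_1comp X Y (u : qm_hom X Y) : qm_comp (qm_id Y) u = u.
Proof. exact: qm_hom_eq. Qed.

Lemma qm_compA X Y Z W (w : qm_hom Z W) (v : qm_hom Y Z) (u : qm_hom X Y) :
  qm_comp w (qm_comp v u) = qm_comp (qm_comp w v) u.
Proof. exact: qm_hom_eq. Qed.

Definition Xplus : category := Category qm_comp1 qm_1comp qm_compA.

End qm_category.

Arguments Lip1_plus {R} X _.

Definition pointwise_closure (R : realType) (T : Type) (F : set (T -> R)) :
  set (T -> R) := closure (F : set {ptws T -> R}).

Definition family_values (R : realType) (T : Type) (F : set (T -> R))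
  (x x' : T) : set R := [set `|f x - f x'| | f in F].

Definition family_dist (R : realType) (T : Type) (F : set (T -> R))
  (x x' : T) : R := sup (family_values F x x').

(** [sup] is the real supremum, with a default value on unbounded sets, so
    finiteness of the distance is required separately by [gd_bounded]. *)
Record gdset (R : realType) := GDSet {
  gd_carrier :> pointedType ;
  gd_family : set (gd_carrier -> R) ;
  gd_family0 : gd_family !=set0 ;
  gd_bounded : forall x x', has_ubound (family_values gd_family x x') ;
  gd_metric : is_metric (family_dist gd_family) ;
  gd_complete : complete (mspace gd_metric) ;
  gd_separable : separable (mspace gd_metric) ;
  gd_mu : probability (borel (mspace gd_metric)) R ;
  gd_full_support : full_support gd_mu }.

Arguments gd_family {R} X : rename.
Arguments gd_metric {R} X : rename.
Arguments gd_mu {R} X : rename.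

Definition gd_borel (R : realType) (X : gdset R) :=
  borel (mspace (gd_metric X)).

Record domination (R : realType) (X Y : gdset R) := Domination {
  gd_fun :> X -> Y ;
  gd_fun_measurable :
    measurable_fun [set: gd_borel X] (gd_fun : gd_borel X -> gd_borel Y) ;
  gd_fun_mu : forall A, measurable A ->
    pushforward (gd_mu X) (gd_fun : gd_borel X -> gd_borel Y) A = gd_mu Y A ;
  gd_fun_family : [set f \o gd_fun | f in gd_family Y] `<=`
    pointwise_closure (gd_family X) }.

Section pointwise_closure_theory.
Variable R : realType.

Lemma pointwise_closure_sub (T : Type) (F : set (T -> R)) :
  F `<=` pointwise_closure F.
Proof. exact: (@subset_closure {ptws T -> R}). Qed.

Lemma pointwise_closure_closure (T : Type) (F : set (T -> R)) :
  pointwise_closure (pointwise_closure F) `<=` pointwise_closure F.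
Proof. exact: (@closed_closure {ptws T -> R}). Qed.

Lemma pointwise_closureS (T : Type) (F G : set (T -> R)) :
  F `<=` G -> pointwise_closure F `<=` pointwise_closure G.
Proof. exact: (@closureS {ptws T -> R}). Qed.

Lemma eval_continuous (T : pointedType) (x : T) :
  continuous (fun f : {ptws T -> R} => f x : R).
Proof. exact: (@proj_continuous T (fun=> R) x). Qed.

Lemma pointwise_cvg (S : pointedType) (F : set_system {ptws S -> R})
    (f : {ptws S -> R}) :
  Filter F -> (forall s, (fun g : {ptws S -> R} => g s) @ F --> f s) -> F --> f.
Proof.
move=> FF Ff.
apply (@cvg_sup (S -> R) S
  (fun s => Topological.class (initial_topology (fun g : S -> R => g s)))
  F f FF) => s.
have evalT : (fun v : S -> R => v s) @` setT = setT.
  by rewrite eqEsubset; split=> v // _; exists (cst v).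
apply (@cvg_image (S -> R) R (fun v : S -> R => v s) F f FF evalT) => W Ws.
exists ((fun v : S -> R => v s) @^-1` W); first exact: (Ff s W Ws).
by rewrite eqEsubset; split=> [r [? + <-//]|r Wr]; exists (cst r).
Qed.

Lemma precomp_continuous (S T : pointedType) (u : S -> T) :
  continuous (fun f : {ptws T -> R} => f \o u : {ptws S -> R}).
Proof.
move=> f; set pre := fun g : {ptws T -> R} => g \o u : {ptws S -> R}.
have preF := @fmap_filter _ _ pre (nbhs f) (nbhs_filter f).
apply (@pointwise_cvg S (pre @ f) (pre f) preF) => s.
exact: (@eval_continuous T (u s) f).
Qed.

Lemma precomp_closure (S T : pointedType) (u : S -> T)
    (F : set (T -> R)) (G : set (S -> R)) :
  [set f \o u | f in F] `<=` pointwise_closure G ->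
  [set f \o u | f in pointwise_closure F] `<=` pointwise_closure G.
Proof.
move=> FG _ [f Ff <-]; apply: pointwise_closure_closure => B fB.
have [g [Fg Bg]] := Ff _ (precomp_continuous fB).
by exists (g \o u); split=> //; apply: FG; exists g.
Qed.

Lemma closure_diff_le (T : pointedType) (F : set (T -> R)) (x y : T) (c : R) :
  (forall f, F f -> f y - f x <= c) ->
  forall f, pointwise_closure F f -> f y - f x <= c.
Proof.
move=> Fc f Ff; apply/ler_addgt0Pl => e e0.
have e2 : 0 < e / 2 by rewrite divr_gt0.
have fxe : nbhs (f : {ptws T -> R})
    ((fun g : {ptws T -> R} => g x) @^-1` ball (f x) (e / 2)).
  by apply: eval_continuous; exact: nbhsx_ballx.
have fye : nbhs (f : {ptws T -> R})
    ((fun g : {ptws T -> R} => g y) @^-1` ball (f y) (e / 2)).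
  by apply: eval_continuous; exact: nbhsx_ballx.
have [g [Fg [/= gx gy]]] := Ff _ (filterI fxe fye).
have {}gx : `|f x - g x| < e / 2 := gx.
have {}gy : `|f y - g y| < e / 2 := gy.
have := Fc g Fg; move: gx gy; rewrite !ltr_distl.
by move=> /andP[gx1 gx2] /andP[gy1 gy2]; lra.
Qed.

End pointwise_closure_theory.

Section gd_category.
Variable R : realType.
Implicit Types X Y Z W : gdset R.

Lemma gd_hom_eq X Y (u v : domination X Y) : gd_fun u = gd_fun v -> u = v.
Proof.
case: u v => [u um umu uF] [v vm vmu vF] /= uv; subst v.
rewrite (Prop_irrelevance um vm) (Prop_irrelevance umu vmu).
by rewrite (Prop_irrelevance uF vF).
Qed.

Lemma gd_id_measurable X :
  measurable_fun [set: gd_borel X] (id : gd_borel X -> gd_borel X).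
Proof. exact: measurable_id. Qed.

Lemma gd_id_family X : [set f \o (id : X -> X) | f in gd_family X] `<=`
  pointwise_closure (gd_family X).
Proof. by move=> _ [f Ff <-]; exact: pointwise_closure_sub. Qed.

Definition gd_id X : domination X X :=
  Domination (@gd_id_measurable X) (fun _ _ => erefl) (@gd_id_family X).

Lemma gd_comp_measurable X Y Z (v : domination Y Z) (u : domination X Y) :
  measurable_fun [set: gd_borel X] (v \o u : gd_borel X -> gd_borel Z).
Proof.
move=> _ A mA; rewrite setTI comp_preimage.
have mvA := gd_fun_measurable v measurableT mA; rewrite setTI in mvA.
by have := gd_fun_measurable u measurableT mvA; rewrite setTI.
Qed.

Lemma gd_comp_mu X Y Z (v : domination Y Z) (u : domination X Y) A :
  measurable A ->
  pushforward (gd_mu X) (v \o u : gd_borel X -> gd_borel Z) A = gd_mu Z A.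
Proof.
move=> mA; rewrite -(gd_fun_mu v mA) /pushforward -(gd_fun_mu u) //.
by rewrite -[X in measurable X]setTI; exact: (gd_fun_measurable v).
Qed.

Lemma gd_comp_family X Y Z (v : domination Y Z) (u : domination X Y) :
  [set f \o (v \o u) | f in gd_family Z] `<=` pointwise_closure (gd_family X).
Proof.
move=> _ [f Ff <-]; apply: (precomp_closure (@gd_fun_family _ _ _ u)).
by exists (f \o v) => //; apply: gd_fun_family; exists f.
Qed.

Definition gd_comp X Y Z (v : domination Y Z) (u : domination X Y) :
  domination X Z :=
  Domination (gd_comp_measurable v u) (gd_comp_mu v u)
    (@gd_comp_family X Y Z v u).

Lemma gd_comp1 X Y (u : domination X Y) : gd_comp u (gd_id X) = u.
Proof. exact: gd_hom_eq. Qed.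

Lemma gd_1comp X Y (u : domination X Y) : gd_comp (gd_id Y) u = u.
Proof. exact: gd_hom_eq. Qed.

Lemma gd_compA X Y Z W (w : domination Z W) (v : domination Y Z)
  (u : domination X Y) : gd_comp w (gd_comp v u) = gd_comp (gd_comp w v) u.
Proof. exact: gd_hom_eq. Qed.

Definition gd_category : category := Category gd_comp1 gd_1comp gd_compA.

End gd_category.

Definition Lip1_plus_real (R : realType) : set (R -> R) :=
  [set p | {homo p : s t / s <= t} /\ forall s t, `|p s - p t| <= `|s - t|].

Arguments Lip1_plus_real R _ : clear implicits.

Definition Lip1_plus_stable (R : realType) (X : gd_category R) : Prop :=
  forall p f, Lip1_plus_real R p -> pointwise_closure (gd_family X) f ->
    pointwise_closure (gd_family X) (p \o f).

Definition LipD (R : realType) : category :=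
  full_subcategory (@Lip1_plus_stable R).

Section Rep.
Variable R : realType.
Implicit Types X Y : qmspace R.

Lemma Lip1_plus_closed X : pointwise_closure (Lip1_plus X) `<=` Lip1_plus X.
Proof. by move=> f Ff x y; apply: closure_diff_le Ff => g; exact. Qed.

Lemma Lip1_plus0 X : Lip1_plus X !=set0.
Proof. by exists (qm_dist X point); exact: Lip1_plus_dist. Qed.

Lemma Lip1_plus_ubound X (x x' : X) :
  ubound (family_values (Lip1_plus X) x x')
    (dist_symmetrization (qm_dist X) x x').
Proof.
move=> _ [f Lf <-]; rewrite ler_norml /dist_symmetrization.
rewrite lerNl opprB !le_max (Lf x x') (Lf x' x) /= orbT.
by [].
Qed.

Lemma Lip1_plus_bounded X (x x' : X) :
  has_ubound (family_values (Lip1_plus X) x x').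
Proof.
exists (dist_symmetrization (qm_dist X) x x'); exact: Lip1_plus_ubound.
Qed.

Lemma Lip1_plus_family_dist X (x x' : X) :
  dist_symmetrization (qm_dist X) x x' = family_dist (Lip1_plus X) x x'.
Proof.
apply/eqP; rewrite eq_le; apply/andP; split; last first.
  apply: ge_sup; last exact: Lip1_plus_ubound.
  have [f Lf] := Lip1_plus0 X.
  by exists `|f x - f x'|, f.
rewrite /dist_symmetrization ge_max; apply/andP; split.
  apply: ub_le_sup; first exact: Lip1_plus_bounded.
  exists (qm_dist X x); first exact: Lip1_plus_dist.
  by rewrite qm_dist_xx sub0r normrN ger0_norm// qm_dist_ge0.
apply: ub_le_sup; first exact: Lip1_plus_bounded.
exists (qm_dist X x'); first exact: Lip1_plus_dist.
by rewrite qm_dist_xx subr0 ger0_norm// qm_dist_ge0.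
Qed.

Lemma Rep_metric X : is_metric (family_dist (Lip1_plus X)).
Proof.
suff <- : dist_symmetrization (qm_dist X) = family_dist (Lip1_plus X).
  exact: qm_metric.
by apply/funext => x; apply/funext => x'; exact: Lip1_plus_family_dist.
Qed.

Definition Rep_gdset X : gdset R :=
  @GDSet R X (Lip1_plus X) (Lip1_plus0 X) (@Lip1_plus_bounded X) (Rep_metric X)
    (complete_same_dist (Rep_metric X) (@Lip1_plus_family_dist X)
      (@qm_complete _ X))
    (separable_same_dist (Rep_metric X) (@Lip1_plus_family_dist X)
      (@qm_separable _ X))
    (same_dist_probability (Rep_metric X) (@Lip1_plus_family_dist X) (qm_mu X))
    (full_support_same_dist (Rep_metric X) (@Lip1_plus_family_dist X)
      (@qm_full_support _ X)).

Lemma Rep_stable X : Lip1_plus_stable (Rep_gdset X).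
Proof.
move=> p f [pm pl] Lf; apply: pointwise_closure_sub => x y /=.
have fxy := Lip1_plus_closed Lf x y.
have [fle|/ltW fle] := leP (f x) (f y).
  by rewrite (le_trans _ fxy)// (le_trans (ler_norm _))// (le_trans (pl _ _))//
    ger0_norm// subr_ge0.
by rewrite (le_trans _ (qm_dist_ge0 _ _))// subr_le0 pm.
Qed.

Definition Rep_obj X : LipD R := exist _ (Rep_gdset X) (@Rep_stable X).

Section Rep_hom.
Variables (X Y : qmspace R) (u : qm_hom X Y).

Lemma Rep_measurable : measurable_fun [set: gd_borel (Rep_gdset X)]
  (qm_fun u : gd_borel (Rep_gdset X) -> gd_borel (Rep_gdset Y)).
Proof.
move=> _ A mA; rewrite setTI.
have mA' := measurable_same_dist (qm_metric Y) (@Lip1_plus_family_dist Y) mA.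
apply: (measurable_same_dist (Rep_metric X) (dm' := qm_metric X)
  (fun x x' => esym (@Lip1_plus_family_dist X x x'))).
by rewrite -[X in measurable X]setTI; exact: (qm_fun_measurable u).
Qed.

Lemma Rep_mu A : measurable A ->
  pushforward (gd_mu (Rep_gdset X))
    (qm_fun u : gd_borel (Rep_gdset X) -> gd_borel (Rep_gdset Y)) A =
  gd_mu (Rep_gdset Y) A.
Proof.
move=> mA.
have mA' := measurable_same_dist (qm_metric Y) (@Lip1_plus_family_dist Y) mA.
exact: (qm_fun_mu u mA').
Qed.

Lemma Rep_family : [set f \o qm_fun u | f in gd_family (Rep_gdset Y)] `<=`
  pointwise_closure (gd_family (Rep_gdset X)).
Proof.
move=> _ [f Lf <-]; apply: pointwise_closure_sub => x y /=.
exact: le_trans (Lf _ _) (qm_fun_dist u _ _).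
Qed.

Definition Rep_hom : domination (Rep_gdset X) (Rep_gdset Y) :=
  Domination Rep_measurable Rep_mu Rep_family.

End Rep_hom.

Lemma Rep_id X : Rep_hom (qm_id X) = gd_id (Rep_gdset X).
Proof. exact: gd_hom_eq. Qed.

Lemma Rep_comp X Y (Z : qmspace R) (v : qm_hom Y Z) (u : qm_hom X Y) :
  Rep_hom (qm_comp v u) = gd_comp (Rep_hom v) (Rep_hom u).
Proof. exact: gd_hom_eq. Qed.

Definition Rep : functor (Xplus R) (LipD R) :=
  @Functor (Xplus R) (LipD R) Rep_obj Rep_hom Rep_id Rep_comp.

End Rep.

Definition plus_dist (R : realType) (X : gdset R) (x x' : X) : R :=
  sup [set f x' - f x | f in pointwise_closure (gd_family X)].

Section Rec.
Variable R : realType.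
Implicit Types X Y Z : LipD R.

Lemma plus_ub (X : gdset R) (x x' : X) (f : X -> R) :
  pointwise_closure (gd_family X) f ->
  f x' - f x <= family_dist (gd_family X) x x'.
Proof.
apply: closure_diff_le => g Fg; apply: (le_trans (ler_norm _)).
by rewrite distrC; apply: ub_le_sup; [exact: gd_bounded|exists g].
Qed.

Lemma plus_bounded (X : gdset R) (x x' : X) :
  has_ubound [set f x' - f x | f in pointwise_closure (gd_family X)].
Proof.
by exists (family_dist (gd_family X) x x') => _ [f Ff <-]; exact: plus_ub.
Qed.

Lemma plus_dist_ub (X : gdset R) (x x' : X) (f : X -> R) :
  pointwise_closure (gd_family X) f -> f x' - f x <= plus_dist x x'.
Proof.
by move=> Ff; apply: ub_le_sup; [exact: plus_bounded|exists f].
Qed.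

Lemma plus_dist_le (X : gdset R) (x x' : X) (c : R) :
  (forall f, pointwise_closure (gd_family X) f -> f x' - f x <= c) ->
  plus_dist x x' <= c.
Proof.
move=> Fc; apply: ge_sup; last by move=> _ [f Ff <-]; exact: Fc.
have [f Ff] := @gd_family0 _ X.
by exists (f x' - f x), f => //; exact: pointwise_closure_sub.
Qed.

Lemma plus_dist_ge0 X (x x' : sval X) : 0 <= plus_dist x x'.
Proof.
case: X x x' => X stX x x' /=; have [f Ff] := @gd_family0 _ X.
have F0 : pointwise_closure (gd_family X) (cst 0 \o f).
  apply: (stX (cst 0) f); last exact: pointwise_closure_sub.
  by split=> [//|s t]; rewrite /cst/= subrr normr0.
by have := plus_dist_ub x x' F0; rewrite /= subrr.
Qed.

Lemma plus_dist_xx (X : gdset R) (x : X) : plus_dist x x = 0.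
Proof.
apply/eqP; rewrite eq_le; apply/andP; split.
  by apply: plus_dist_le => f _; rewrite subrr.
have [f Ff] := @gd_family0 _ X.
by have := plus_dist_ub x x (pointwise_closure_sub Ff); rewrite subrr.
Qed.

Lemma plus_dist_tri (X : gdset R) (y x z : X) :
  plus_dist x z <= plus_dist x y + plus_dist y z.
Proof.
apply: plus_dist_le => f Ff; rewrite -(subrKA (f y)) addrC.
by apply: lerD; exact: plus_dist_ub.
Qed.

Lemma plus_dist_symmetrization (X : gdset R) (x x' : X) :
  family_dist (gd_family X) x x' = dist_symmetrization (@plus_dist R X) x x'.
Proof.
apply/eqP; rewrite eq_le; apply/andP; split.
  apply: ge_sup => [|_ [f Ff <-]].
    by have [f Ff] := @gd_family0 _ X; exists `|f x - f x'|, f.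
  rewrite ler_norml lerNl opprB !le_max.
  by rewrite !plus_dist_ub ?orbT //; exact: pointwise_closure_sub.
rewrite ge_max; apply/andP; split; apply: plus_dist_le => f.
  exact: plus_ub.
by rewrite (dist_sym (gd_metric X)); exact: plus_ub.
Qed.

Lemma Rec_metric (X : gdset R) :
  is_metric (dist_symmetrization (@plus_dist R X)).
Proof.
suff <- : family_dist (gd_family X) = dist_symmetrization (@plus_dist R X).
  exact: gd_metric.
by apply/funext => x; apply/funext => x'; exact: plus_dist_symmetrization.
Qed.

Definition Rec_obj X : qmspace R :=
  @QMSpace R (sval X) (@plus_dist R (sval X)) (@plus_dist_ge0 X)
    (@plus_dist_xx (sval X)) (@plus_dist_tri (sval X)) (Rec_metric (sval X))
    (complete_same_dist (Rec_metric (sval X))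
      (@plus_dist_symmetrization (sval X)) (@gd_complete _ (sval X)))
    (separable_same_dist (Rec_metric (sval X))
      (@plus_dist_symmetrization (sval X)) (@gd_separable _ (sval X)))
    (same_dist_probability (Rec_metric (sval X))
      (@plus_dist_symmetrization (sval X)) (gd_mu (sval X)))
    (full_support_same_dist (Rec_metric (sval X))
      (@plus_dist_symmetrization (sval X)) (@gd_full_support _ (sval X))).

Section Rec_hom.
Variables (X Y : LipD R) (u : domination (sval X) (sval Y)).

Lemma Rec_mu A : measurable A ->
  pushforward (qm_mu (Rec_obj X))
    (gd_fun u : qm_borel (Rec_obj X) -> qm_borel (Rec_obj Y)) A =
  qm_mu (Rec_obj Y) A.
Proof.
move=> mA.
have mA' := measurable_same_dist (gd_metric (sval Y))
  (@plus_dist_symmetrization (sval Y)) mA.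
exact: (gd_fun_mu u mA').
Qed.

Lemma Rec_dist x x' :
  qm_dist (Rec_obj Y) (gd_fun u x) (gd_fun u x') <= qm_dist (Rec_obj X) x x'.
Proof.
apply: plus_dist_le => f Ff.
apply: (@plus_dist_ub (sval X) x x' (f \o u)).
by apply: (precomp_closure (@gd_fun_family _ _ _ u)); exists f.
Qed.

Definition Rec_hom : qm_hom (Rec_obj X) (Rec_obj Y) := QMHom Rec_mu Rec_dist.

End Rec_hom.

Lemma Rec_id X : Rec_hom (gd_id (sval X)) = qm_id (Rec_obj X).
Proof. exact: qm_hom_eq. Qed.

Lemma Rec_comp X Y Z (v : domination (sval Y) (sval Z))
    (u : domination (sval X) (sval Y)) :
  Rec_hom (gd_comp v u) = qm_comp (Rec_hom v) (Rec_hom u).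
Proof. exact: qm_hom_eq. Qed.

Definition Rec : functor (LipD R) (Xplus R) :=
  @Functor (LipD R) (Xplus R) Rec_obj Rec_hom Rec_id Rec_comp.

End Rec.

(* Main.v *)
Require Import Defs.
From mathcomp Require Import all_boot all_order all_algebra.
From mathcomp Require Import boolp classical_sets reals.
From mathcomp Require Import measure.

(** The adjunction is assembled from a unit [Y -> Rec (Rep Y)] and a counit
    [Rep (Rec X) -> X], both with the identity as underlying map.

    For a qm-space [Y] the family [Lip1_plus Y] is already closed under
    pointwise limits, so the distance of [Rec (Rep Y)] is the supremum of
    [f y' - f y] over [Lip1_plus Y].  It is at most [qm_dist Y y y'] by the
    definition of [Lip1_plus], and this value is attained at the function
    [qm_dist Y y].  Hence [Rec (Rep Y)] carries the distance of [Y], and the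
    identity is an isomorphism ([rec_rep_dist], [unit_iso]).

    For a gd-set [X] the distance of [Rec X] is built to dominate every increment
    of a function of the family, that is, the family of [X] is contained in the
    one of [Rep (Rec X)], and the identity is a domination
    ([rep_rec_counit]).

    A domination [u : Rep Y -> X] is sent to [Rec u] precomposed with the unit,
    and a morphism [v : Y -> Rec X] to [Rep v] postcomposed with the counit.
    Neither changes the underlying map.  A morphism of either category
    is determined by its underlying map, so naturality and bijectivity are
    equalities between morphisms with the same underlying map.  Fullness of [Rep]
    then comes from composing the transpose of a domination
    [Rep Y -> Rep Z] with the inverse of the unit at [Z]. *)

Set Implicit Arguments.
Unset Strict Implicit.
Unset Printing Implicit Defensive.

Import Order.TTheory GRing.Theory Num.Theory.

Local Open Scope classical_set_scope.
Local Open Scope ring_scope.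

Section RepRec.
Variable R : realType.
Implicit Types (X : LipD R) (Y Z : Xplus R).

(** The supremum defining the left-hand side is attained at the distance
    function from [y]. *)
Lemma rec_rep_dist Y (y y' : Y) :
  qm_dist (Rec_obj (Rep_obj Y)) y y' = qm_dist Y y y'.
Proof.
apply/eqP; rewrite eq_le; apply/andP; split.
  by apply: (@plus_dist_le R (Rep_gdset Y)) => f Lf; exact: Lip1_plus_closed.
have := @plus_dist_ub R (Rep_gdset Y) y y' _
  (pointwise_closure_sub (Lip1_plus_dist y)).
by rewrite qm_dist_xx subr0.
Qed.

Lemma rec_rep_mu Y A : qm_mu (Rec_obj (Rep_obj Y)) A = qm_mu Y A.
Proof. by []. Qed.

Lemma rec_rep_dist_le Y (y y' : Y) :
  qm_dist (Rec_obj (Rep_obj Y)) y y' <= qm_dist Y y y'.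
Proof. by rewrite rec_rep_dist. Qed.

Lemma rec_rep_dist_ge Y (y y' : Y) :
  qm_dist Y y y' <= qm_dist (Rec_obj (Rep_obj Y)) y y'.
Proof. by rewrite rec_rep_dist. Qed.

Definition rec_rep_unit Y : qm_hom Y (Rec_obj (Rep_obj Y)) :=
  @QMHom R Y (Rec_obj (Rep_obj Y)) id (fun A _ => esym (@rec_rep_mu Y A))
    (@rec_rep_dist_le Y).

Definition rec_rep_unit_inv Y : qm_hom (Rec_obj (Rep_obj Y)) Y :=
  @QMHom R (Rec_obj (Rep_obj Y)) Y id (fun A _ => @rec_rep_mu Y A)
    (@rec_rep_dist_ge Y).

(** Both sides are the symmetrization of [plus_dist].  In particular [X] and
    [Rep (Rec X)] have the same Borel sets, which makes the counit measurable
    and measure preserving. *)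
Lemma rep_rec_family_dist X (x x' : sval X) :
  family_dist (Lip1_plus (Rec_obj X)) x x' =
  family_dist (gd_family (sval X)) x x'.
Proof.
rewrite (plus_dist_symmetrization x x').
by rewrite -(Lip1_plus_family_dist (X := Rec_obj X)).
Qed.

Lemma rep_rec_measurable X :
  measurable_fun [set: gd_borel (Rep_gdset (Rec_obj X))]
    (id : gd_borel (Rep_gdset (Rec_obj X)) -> gd_borel (sval X)).
Proof.
move=> _ A mA; rewrite setTI.
exact: (measurable_same_dist (Rep_metric (Rec_obj X))
  (@rep_rec_family_dist X) mA).
Qed.

Lemma rep_rec_mu X A : gd_mu (Rep_gdset (Rec_obj X)) A = gd_mu (sval X) A.
Proof. by []. Qed.

(** A function of the family, being in its closure, has increments bounded by
    the supremum [plus_dist], so it lies in [Lip1_plus (Rec X)]. *)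
Lemma rep_rec_family X :
  [set f \o (id : Rep_gdset (Rec_obj X) -> sval X) | f in gd_family (sval X)]
  `<=` pointwise_closure (gd_family (Rep_gdset (Rec_obj X))).
Proof.
move=> _ [f Ff <-]; apply: pointwise_closure_sub => x x'.
by apply: plus_dist_ub; exact: pointwise_closure_sub.
Qed.

Definition rep_rec_counit X : domination (Rep_gdset (Rec_obj X)) (sval X) :=
  Domination (@rep_rec_measurable X) (fun A _ => @rep_rec_mu X A)
    (@rep_rec_family X).

Definition transpose Y X (u : mor (Rep R Y) X) : mor Y (Rec R X) :=
  qm_comp (Rec_hom (X := Rep_obj Y) u) (rec_rep_unit Y).

Definition untranspose Y X (v : mor Y (Rec R X)) : mor (Rep R Y) X :=
  gd_comp (rep_rec_counit X) (Rep_hom v).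

Lemma transpose_bij Y X : bijective (@transpose Y X).
Proof.
by exists (@untranspose Y X) => u; [exact: gd_hom_eq|exact: qm_hom_eq].
Qed.

Lemma transpose_natl Y Z X (f : mor Z Y) (u : mor (Rep R Y) X) :
  transpose (compm u (Defs.fmap (Rep R) f)) = compm (transpose u) f.
Proof. exact: qm_hom_eq. Qed.

Lemma transpose_natr Y X X' (h : mor X X') (u : mor (Rep R Y) X) :
  transpose (compm h u) = compm (Defs.fmap (Rec R) h) (transpose u).
Proof. exact: qm_hom_eq. Qed.

Definition rep_rec_adjunction : adjunction (Rep R) (Rec R) :=
  Adjunction transpose_bij transpose_natl transpose_natr.

Lemma unit_iso : nat_isomorphism (adj_unit rep_rec_adjunction).
Proof.
by move=> Y; exists (rec_rep_unit_inv Y); split; exact: qm_hom_eq.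
Qed.

Lemma rep_fully_faithful : fully_faithful (Rep R).
Proof.
split=> [Y Z g|Y Z u v uv].
  exists (qm_comp (rec_rep_unit_inv Z) (transpose g)); exact: gd_hom_eq.
exact/qm_hom_eq/(congr1 (@gd_fun R (Rep_gdset Y) (Rep_gdset Z)) uv).
Qed.

End RepRec.

Theorem theorem2p11 (R : realType) :
  exists phi : adjunction (Rep R) (Rec R),
    (forall (Y : Xplus R) (Y' : LipD R) (u : mor (Rep R Y) Y'),
       qm_fun (phi Y Y' u) = gd_fun u) /\
    nat_isomorphism (adj_unit phi) /\
    fully_faithful (Rep R).
Proof.
exists (rep_rec_adjunction R); split=> //.
by split; [exact: unit_iso|exact: rep_fully_faithful].
Qed.
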